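(* Let $(W,S)$ be a Coxeter group. Assume that Lusztig's $a$-function on $W$ is bounded by the length of the longest element $w_0$ of a finite parabolic subgroup $P$ of $W$, i.e. $a(w)\le l(w_0)$ for all $w\in W$. Then the two-sided cell of $W$ containing $w_0$ is the lowest two-sided cell of $W$. Moreover, the lowest two-sided cell contains all elements $w\in W$ with $a(w)=l(w_0)$.
   Context: $l$ is the length function of $(W,S)$, $\le$ the Bruhat order, $e$ the neutral element. A parabolic subgroup is a subgroup generated by a subset of $S$. Hecke algebra: $H$ is the algebra over $\mathcal A=\mathbb Z[q^{1/2},q^{-1/2}]$ ($q$ an indeterminate), free with basis $T_w$ ($w\in W$), with $(T_s-q)(T_s+1)=0$ for $s\in S$ and $T_wT_u=T_{wu}$ if $l(wu)=l(w)+l(u)$. Let $P_{y,w}\in\mathbb Z[q]$ be the Kazhdan-Lusztig polynomials and $C_w=q^{-l(w)/2}\sum_{y\le w}P_{y,w}T_y$; the $C_w$ form a basis of $H$. Write $C_wC_u=\sum_{v}h_{w,u,v}C_v$ with $h_{w,u,v}\in\mathcal A$. Lusztig's $a$-function: $a(v)=\max\{i\in\mathbb N\mid i=\deg h_{w,u,v},\ w,u\in W\}$, the degree being the highest power of $q^{1/2}$ that occurs. Cells: $\leq_L$ is the preorder on $W$ generated by the relations $x\leq_L y$ whenever $C_x$ occurs with nonzero coefficient in $C_sC_y$ for some $s\in S$; $x\leq_R y$ means $x^{-1}\leq_L y^{-1}$; $\leq_{LR}$ is the preorder generated by $\leq_L$ and $\leq_R$. The equivalence classes of the equivalence relations associated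 to $\leq_L$ and $\leq_{LR}$ are the left cells and the two-sided cells. $\leq_{LR}$ induces a partial order on the set of two-sided cells; the lowest two-sided cell is the one that is $\leq_{LR}$ every two-sided cell (the least element of this partial order). *)

(* Defs.v *)
From HB Require Import structures.
From Stdlib Require Import Relation_Operators.
From mathcomp Require Import all_boot all_order all_algebra.
From mathcomp Require Import boolp classical_sets cardinality fsbigop.

Set Implicit Arguments.
Unset Strict Implicit.
Unset Printing Implicit Defensive.

Import GRing.Theory.

Local Open Scope classical_set_scope.
Local Open Scope ring_scope.

Section CoxeterSystems.
Variables (W : groupType) (S : set W).

Definition has_order (G : groupType) (x : G) (m : nat) : Prop :=
  [/\ (0 < m)%N, (x ^+ m)%g = 1%g
    & forall k, (0 < k < m)%N -> (x ^+ k)%g <> 1%g].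

Definition generated (I : set W) : set W :=
  smallest [set G : set W |
    G 1%g /\ forall x y, G x -> G y -> G (x * y^-1)%g] I.

(* Bourbaki, Lie IV.1.3: [W] is presented by the involutions in [S] and the
   relations (st)^m(s,t) = 1, where m(s,t) is the order of st when finite; the
   presentation is expressed by its universal property.  Only the values of [f]
   on [S] are relevant. *)
Definition coxeter_system : Prop :=
  [/\ forall s, S s -> has_order s 2,
      generated S = [set: W]
    & forall (G : groupType) (f : W -> G),
        (forall s t m, S s -> S t -> has_order (s * t)%g m ->
           ((f s * f t) ^+ m)%g = 1%g) ->
        exists g : {multiplicative W -> G}, forall s, S s -> g s = f s].

Definition expressible (w : W) : set nat :=
  [set n | exists r : seq W,
     [/\ size r = n, forall s, s \in r -> S s & (\prod_(s <- r) s)%g = w]].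

Definition len (w : W) : nat :=
  xget 0%N [set n | expressible w n /\
                    forall m, expressible w m -> (n <= m)%N].

Definition reflection (t : W) : Prop :=
  exists x s, S s /\ t = (x * s * x^-1)%g.

Definition bruhat : W -> W -> Prop :=
  clos_refl_trans W (fun y w =>
    (exists2 t, reflection t & w = (y * t)%g) /\ (len y < len w)%N).

Definition longest_element (P : set W) (w0 : W) : Prop :=
  P w0 /\ forall w, P w -> (len w <= len w0)%N.

End CoxeterSystems.

(* Z[q^(1/2), q^(-1/2)], as the subring of the fraction field of Z[X] consisting
   of the fractions p / X^n; X plays the role of q^(1/2). *)
Section Laurent.

Local Notation "x %:F" := (@FracField.tofrac _ x).

Definition Xfrac : {fraction {poly int}} := 'X%:F.

Definition laurent_pred : {pred {fraction {poly int}}} :=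
  fun x => `[< exists (p : {poly int}) (n : nat), x * Xfrac ^+ n = p%:F >].

Lemma laurent_subring_closed : subring_closed laurent_pred.
Proof.
split=> [|x y /asboolP[p [n hp]] /asboolP[r [m hr]]
         |x y /asboolP[p [n hp]] /asboolP[r [m hr]]]; apply/asboolP.
- by exists 1, 0%N; rewrite expr0 mulr1 tofrac1.
- exists (p * 'X^m - r * 'X^n), (n + m)%N.
  rewrite tofracB !tofracM !tofracXn -hp -hr exprD mulrBl mulrA.
  by rewrite -!mulrA [Xfrac ^+ m * _]mulrC.
- exists (p * r), (n + m)%N.
  by rewrite tofracM -hp -hr exprD mulrACA.
Qed.

HB.instance Definition _ := GRing.isSubringClosed.Build _ laurent_pred
  laurent_subring_closed.

Record laurent := Laurent {
  laurent_val : {fraction {poly int}};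
  laurent_valP : laurent_val \in laurent_pred }.

HB.instance Definition _ := [isSub for laurent_val].
HB.instance Definition _ := [Choice of laurent by <:].
HB.instance Definition _ := [SubChoice_isSubComNzRing of laurent by <:].

Lemma laurent_qhalf_subproof (k : int) : Xfrac ^ k \in laurent_pred.
Proof.
have X0 : Xfrac != 0 by rewrite tofrac_eq0 polyX_eq0.
apply/asboolP; case: k => n.
- by exists 'X^n, 0%N; rewrite expr0 mulr1 tofracXn.
- by exists 1, n.+1; rewrite -[_ ^ _]/(Xfrac ^- n.+1) mulVf ?expf_neq0 ?tofrac1.
Qed.

(* q^(k/2) *)
Definition qhalf (k : int) : laurent := Laurent (laurent_qhalf_subproof k).

Definition q : laurent := qhalf 2.

(* [i] is the highest exponent of q^(1/2) occurring in [f]; in particular no [i]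
   is a degree of 0. *)
Definition has_degree (f : laurent) (i : int) : Prop :=
  exists (p : {poly int}) (n : nat),
    [/\ p != 0, laurent_val f * Xfrac ^+ n = p%:F
      & i = (size p).-1%:Z - n%:Z].

Definition eval_q (p : {poly int}) : laurent := (map_poly intr p).[q].

End Laurent.

Section Bases.
Variables (I : choiceType) (A : nzRingType) (M : lmodType A) (B : I -> M).

Definition is_coords (x : M) (c : I -> A) : Prop :=
  finite_set [set i | c i != 0] /\ x = \sum_(i \in [set: I]) c i *: B i.

Definition is_basis : Prop := forall x, exists! c, is_coords x c.

Definition coord (x : M) : I -> A := xget (fun=> 0) (is_coords x).

End Bases.

Section Hecke.
Variables (W : groupType) (S : set W).
Variables (H : algType laurent) (T : W -> H).

Definition hecke_algebra : Prop :=
  [/\ is_basis T,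
      forall s, S s -> (T s - q%:A) * (T s + 1) = 0
    & forall w u, len S (w * u)%g = (len S w + len S u)%N ->
        T w * T u = T (w * u)%g].

(* As a ring morphism sending q^(1/2) to q^(-1/2), [bar] is semilinear for the
   involution of Z[q^(1/2), q^(-1/2)]. *)
Definition bar_involution (bar : {rmorphism H -> H}) : Prop :=
  [/\ forall x, bar (qhalf 1 *: x) = qhalf (-1) *: bar x,
      forall w, bar (T w) * T (w^-1)%g = 1
    & forall w, T (w^-1)%g * bar (T w) = 1].

Variable P : W -> W -> {poly int}.

Definition C (w : W) : H :=
  qhalf (- (len S w)%:Z) *:
    \sum_(y \in [set y | bruhat S y w]) eval_q (P y w) *: T y.

(* The characterization of Kazhdan and Lusztig (1979, Theorem 1.1), with
   P_{y,w} = 0 when y is not below w.  The inequality reads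
   deg P_{y,w} <= (l(w) - l(y) - 1) / 2. *)
Definition kazhdan_lusztig : Prop :=
  [/\ forall y w, ~ bruhat S y w -> P y w = 0,
      forall w, P w w = 1,
      forall y w, bruhat S y w -> y <> w ->
        ((size (P y w)).-1.*2 + 1 <= len S w - len S y)%N
    & exists2 bar : {rmorphism H -> H},
        bar_involution bar & forall w, bar (C w) = C w].

Definition h (w u v : W) : laurent := coord C (C w * C u) v.

Definition h_degrees (v : W) : set nat :=
  [set i | exists w u, has_degree (h w u v) i%:Z].

(* [None] stands for an infinite value (no maximum). *)
Definition afun (v : W) : option nat :=
  xget None [set o | exists2 n, o = Some n &
    h_degrees v n /\ forall i, h_degrees v i -> (i <= n)%N].

Definition le_L : W -> W -> Prop :=
  clos_refl_trans W (fun x y => exists2 s, S s & coord C (C s * C y) x != 0).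

Definition le_R (x y : W) : Prop := le_L (x^-1)%g (y^-1)%g.

Definition le_LR : W -> W -> Prop :=
  clos_refl_trans W (fun x y => le_L x y \/ le_R x y).

Definition two_sided_cell (w : W) : set W :=
  [set x | le_LR x w /\ le_LR w x].

Definition is_two_sided_cell (D : set W) : Prop :=
  exists w, D = two_sided_cell w.

Definition cell_le (D E : set W) : Prop :=
  exists x y, [/\ D x, E y & le_LR x y].

Definition lowest_two_sided_cell (D : set W) : Prop :=
  is_two_sided_cell D /\ forall E, is_two_sided_cell E -> cell_le D E.

End Hecke.

(* Main.v *)
Require Import Defs.
From HB Require Import structures.
From Stdlib Require Import Relation_Operators Operators_Properties.
From mathcomp Require Import all_boot all_order all_algebra.
From mathcomp Require Import finmap boolp classical_sets cardinality fsbigop.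
From mathcomp Require Import zify ring.

(** Write N = l(w_0) and let f_{x,y,z} be the structure constants of the
    normalized standard basis T~_w = q^{-l(w)/2} T_w.  Since the bases (C_w) and
    (T~_w) agree modulo q^{-1/2}, the bound deg h <= N gives deg f <= N and
    deg (f - h) < N.  Hence deg f_{x,y,z^{-1}} = N forces h_{x,y,z^{-1}} <> 0 and
    z^{-1} <=_L y; the symmetries f_{x,y,z^{-1}} = f_{y,z,x^{-1}} (from the trace)
    and f_{x,y,z^{-1}} = f_{y^{-1},x^{-1},z} (from w |-> w^{-1}) then yield
    y ~_L z^{-1} and z ~_L x^{-1}.

    If sv < v for all s in J, then deg f_{w_0,v,v} = N, so v ~_R w_0.  Given any
    w, climbing by left multiplications w < sw with s in J ends at such a v, and
    each step satisfies sw <=_L w; hence w_0 <=_{LR} w.  If moreover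
    deg f_{x,y,w} = N and sw > w, comparing coefficients at T~_{sw} in
    T~_s T~_x T~_y gives deg f_{sx,y,sw} = N, so that w ~_L y ~_L sw; therefore
    a(w) = N implies w ~_L v ~_R w_0.  No cancellation occurs in these comparisons
    because the leading coefficients of all f_{x,y,z} are nonnegative. *)

Set Implicit Arguments.
Unset Strict Implicit.
Unset Printing Implicit Defensive.

Import Order.TTheory GRing.Theory Num.Theory.

Local Open Scope classical_set_scope.
Local Open Scope ring_scope.

(* [vector] also defines a [coord]. *)
Local Notation coord := Defs.coord.

(** * Lifting the Coxeter relations to a semidirect product *)

Section ReflectionCocycle.
Variable W : groupType.
Local Open Scope group_scope.

(* Semidirect product of the group of F_2-valued functions on [W], with [W] acting
   by conjugation of the argument, by [W]. *)
Definition cocycle_group : Type := ((W -> bool) * W)%type.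
HB.instance Definition _ := Choice.on cocycle_group.

Definition cocycle_mul (a b : cocycle_group) : cocycle_group :=
  (fun t => a.1 t (+) b.1 (a.2^-1 * t * a.2), a.2 * b.2).
Definition cocycle_one : cocycle_group := (fun=> false, 1).
Definition cocycle_inv (a : cocycle_group) : cocycle_group :=
  (fun t => a.1 (a.2 * t * a.2^-1), a.2^-1).

Lemma cocycle_eq (a b : cocycle_group) : a.1 =1 b.1 -> a.2 = b.2 -> a = b.
Proof. by case: a b => [A x] [B y] /= /funext -> ->. Qed.

Lemma cocycle_mulA : associative cocycle_mul.
Proof.
move=> a b c; apply: cocycle_eq => /= [t|]; last exact: mulgA.
by rewrite addbA invgM !mulgA.
Qed.

Lemma cocycle_mul1 : left_id cocycle_one cocycle_mul.
Proof.
by move=> a; apply: cocycle_eq => /= [t|]; rewrite ?invg1 ?mul1g ?mulg1.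
Qed.

Lemma cocycle_mulr1 : right_id cocycle_one cocycle_mul.
Proof. by move=> a; apply: cocycle_eq => /= [t|]; rewrite ?addbF ?mulg1. Qed.

Lemma cocycle_mulV : left_inverse cocycle_one cocycle_inv cocycle_mul.
Proof.
move=> a; apply: cocycle_eq => /= [t|]; last exact: mulVg.
by rewrite invgK addbb.
Qed.

Lemma cocycle_mulrV : right_inverse cocycle_one cocycle_inv cocycle_mul.
Proof.
move=> a; apply: cocycle_eq => /= [t|]; last exact: mulgV.
by rewrite !mulgA mulgV mul1g mulgK addbb.
Qed.

HB.instance Definition _ := isGroup.Build cocycle_group cocycle_mulA
  cocycle_mul1 cocycle_mulr1 cocycle_mulV cocycle_mulrV.

(** These lifts of the generators satisfy the Coxeter relations, so the universal property extends
    them to a homomorphism from [W], whose first component is a cocycle. *)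
Definition cocycle_gen (s : W) : cocycle_group := (fun t => t == s, s).


Lemma conj_eq (x u v : W) : (x^-1 * u * x == v) = (u == x * v * x^-1).
Proof.
apply/eqP/eqP => [<-|->]; first by rewrite !mulgA mulgV mul1g mulgK.
by rewrite !mulgA mulVg mul1g mulgVK.
Qed.

(** Dihedral identity: conjugation by the involution [s] inverts [s * t]. *)
Lemma involution_pow (s t : W) n : s * s = 1 -> t * t = 1 ->
  s * (s * t) ^- n = (s * t) ^+ n * s.
Proof.
move=> ss tt; have sV : s^-1 = s by rewrite -[LHS]mulg1 -ss mulKg.
have tV : t^-1 = t by rewrite -[LHS]mulg1 -tt mulKg.
elim: n => [|n IH]; first by rewrite !expg0 invg1 mulg1 mul1g.
rewrite expgSr invgM mulgA invgM sV tV mulgA.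
by rewrite -[s * t * s * _]mulgA IH mulgA -expgS expgSr.
Qed.

Lemma cocycle_gen_pow (s t : W) n u : s * s = 1 -> t * t = 1 ->
  ((cocycle_gen s * cocycle_gen t) ^+ n : cocycle_group).1 u =
    \big[addb/false]_(0 <= j < n.*2) (u == (s * t) ^+ j * s) /\
  ((cocycle_gen s * cocycle_gen t) ^+ n : cocycle_group).2 = (s * t) ^+ n.
Proof.
move=> ss tt; have sV : s^-1 = s by rewrite -[LHS]mulg1 -ss mulKg.
elim: n => [|n [IH1 IH2]]; first by rewrite big_nil !expg0.
rewrite expgSr /= IH1 IH2 expgSr; split => //.
rewrite doubleS !big_nat_recr //= -addbA; congr (_ (+) (_ (+) _)).
  rewrite conj_eq -[_ * s * _]mulgA involution_pow // mulgA -expgnDr.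
  by rewrite addnn.
rewrite !conj_eq sV (mulgA _ (s * t) s) -[_ * s * _]mulgA involution_pow //.
rewrite mulgA -expgSr -expgnDr.
by rewrite addSn addnn.
Qed.

(** The first component of the power is a sum over the reflections (st)^j s for j < 2m. As (st)^m =
    1, the terms j and j + m coincide and cancel modulo 2. *)
Lemma cocycle_braid (s t : W) m : s * s = 1 -> t * t = 1 ->
  (s * t) ^+ m = 1 -> (cocycle_gen s * cocycle_gen t) ^+ m = 1.
Proof.
move=> ss tt stm; apply: cocycle_eq => [u|]; last first.
  by have [_ ->] := cocycle_gen_pow m 1 ss tt.
have [-> _] := cocycle_gen_pow m u ss tt.
rewrite -addnn (big_cat_nat (n := m)) ?leq_addr //=.
rewrite -[X in _ (+) \big[_/_]_(X <= i < _) _]add0n big_addn addnK.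
under [X in _ (+) X]eq_bigr => j _ do rewrite expgnDr stm mulg1.
exact: addbb.
Qed.

End ReflectionCocycle.

(** * Length, strong exchange, reduced words and the Bruhat order *)

Section CoxeterLength.
Variables (W : groupType) (S : set W).
Hypothesis HS : coxeter_system S.
Local Open Scope group_scope.

Lemma gen_mul (s : W) : S s -> s * s = 1.
Proof. by case: HS => H _ _ /H[_]; rewrite expg2. Qed.

Lemma gen_inv (s : W) : S s -> s^-1 = s.
Proof. by move=> /gen_mul ss; rewrite -[LHS]mulg1 -ss mulKg. Qed.

Lemma genK (s w : W) : S s -> s * (s * w) = w.
Proof. by move=> Ss; rewrite mulgA gen_mul ?mul1g. Qed.

Lemma gen_neq1 (s : W) : S s -> s <> 1.
Proof.
case: HS => H _ _ /H[_ _ /(_ 1%N isT)] + s1.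
by rewrite expg1.
Qed.

Lemma word_inv (r : seq W) : (forall s, s \in r -> S s) ->
  (\prod_(s <- r) s)^-1 = \prod_(s <- rev r) s.
Proof.
elim: r => [_|s r IH Sr]; first by rewrite !big_nil invg1.
rewrite rev_cons big_rcons /= big_cons invgM IH ?gen_inv //.
  by apply: Sr; rewrite mem_head.
by move=> t tr; apply: Sr; rewrite in_cons tr orbT.
Qed.

Lemma generated_word (I : set W) (w : W) : I `<=` S -> generated I w ->
  exists2 r : seq W, (forall s, s \in r -> I s) & \prod_(s <- r) s = w.
Proof.
move=> IS /(_ [set w | exists2 r, (forall s, s \in r -> I s) &
  \prod_(s <- r) s = w]); apply; split; last first.
  by move=> s Is; exists [:: s]; rewrite ?big_seq1 // => t /[!inE] /eqP ->.
split; first by exists [::]; rewrite ?big_nil.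
move=> _ _ [r Ir <-] [r' Ir' <-].
exists (r ++ rev r') => [s|].
  by rewrite mem_cat mem_rev => /orP[/Ir|/Ir'].
by rewrite big_cat /= word_inv // => s /Ir' /IS.
Qed.

(** Every element is a product of generators, so the minimum in the definition of [len] exists and
    the default value of [xget] is never taken. *)
Lemma len_spec (w : W) :
  expressible S w (len S w) /\ forall m, expressible S w m -> (len S w <= m)%N.
Proof.
pose A := [set n | expressible S w n /\ forall m, expressible S w m -> (n <= m)%N].
suff: A !=set0 by case=> n An; exact: (xgetI 0%N An).
have: exists n, `[< expressible S w n >].
  have [|r Sr rw] := @generated_word S w (fun _ => id).
    by case: HS => _ -> _.
  by exists (size r); apply/asboolP; exists r.
move=> ex; exists (ex_minn ex); case: ex_minnP => n /asboolP nP nmin.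
by split=> // m /asboolP /nmin.
Qed.

Lemma len_word (w : W) : exists r : seq W,
  [/\ size r = len S w, forall s, s \in r -> S s & \prod_(s <- r) s = w].
Proof. by case: (len_spec w). Qed.

Lemma len_le (r : seq W) : (forall s, s \in r -> S s) ->
  (len S (\prod_(s <- r) s) <= size r)%N.
Proof. by move=> Sr; apply: (len_spec _).2; exists r. Qed.

Lemma len1 : len S 1 = 0%N.
Proof.
by have := @len_le [::]; rewrite big_nil leqn0 => H; apply/eqP/H.
Qed.

Lemma len_eq0 (w : W) : len S w = 0%N -> w = 1.
Proof. by have [[|s r] [<- _ <-]] := len_word w; rewrite ?big_nil. Qed.

Lemma len_mul (x y : W) : (len S (x * y) <= len S x + len S y)%N.
Proof.
have [r [<- Sr <-]] := len_word x; have [r' [<- Sr' <-]] := len_word y.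
rewrite -big_cat -size_cat; apply: len_le => s.
by rewrite mem_cat => /orP[/Sr|/Sr'].
Qed.

Lemma len_inv_le (x : W) : (len S x^-1 <= len S x)%N.
Proof.
have [r [<- Sr <-]] := len_word x; rewrite word_inv // -size_rev.
by apply: len_le => s; rewrite mem_rev; exact: Sr.
Qed.

Lemma len_inv (x : W) : len S x^-1 = len S x.
Proof. by apply/eqP; rewrite eqn_leq len_inv_le -{1}[x]invgK len_inv_le. Qed.

Lemma len_gen (s : W) : S s -> len S s = 1%N.
Proof.
move=> Ss; have := @len_le [:: s]; rewrite big_seq1 => /(_ _)/wrap[].
  by move=> t /[!inE] /eqP ->.
by case E: (len S s) => [|[]] // _; have /gen_neq1 := Ss; rewrite (len_eq0 E).
Qed.

(* [cocycle w] is the indicator of the set of reflections [t] with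
   [len (t * w) < len w]; modulo 2, every word for [w] lists that set. *)
Lemma cocycle_exists : exists N : W -> W -> bool,
  (forall x y t, N (x * y) t = N x t (+) N y (x^-1 * t * x)) /\
  (forall s, S s -> forall t, N s t = (t == s)).
Proof.
case: HS => invS genS /(_ (cocycle_group W) (@cocycle_gen W)) [].
  move=> s t m Ss St [_ stm _].
  by apply: cocycle_braid => //; apply: gen_mul.
move=> g gE; exists (fun w => (g w).1); split; last first.
  by move=> s Ss t; rewrite gE.
(* The second component of [g] is multiplicative and fixes the generators, hence is the identity;
   the group law then gives the cocycle rule for the first. *)
have g2 w : (g w).2 = w.
  have [|r Sr <-] := @generated_word S w (fun _ => id); first by rewrite genS.
  elim: r Sr => [|s r IH] Sr.
    rewrite big_nil; apply: (@mulgI _ (g 1).2); rewrite mulg1.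
    by rewrite -[RHS](congr1 (fun w => (g w).2) (mulg1 1)) gmulfM.
  rewrite big_cons gmulfM /= IH ?gE //; first by apply: Sr; rewrite mem_head.
  by move=> t tr; apply: Sr; rewrite in_cons tr orbT.
by move=> x y t; rewrite gmulfM /= g2.
Qed.

Definition cocycle := sval (cid cocycle_exists).

Lemma cocycleM x y t : cocycle (x * y) t = cocycle x t (+) cocycle y (x^-1 * t * x).
Proof. by rewrite /cocycle; case: cid => N [? ?]. Qed.

Lemma cocycle_s s t : S s -> cocycle s t = (t == s).
Proof. by rewrite /cocycle; case: cid => N [? NE] Ss; exact: NE. Qed.

Lemma cocycle1 t : cocycle 1 t = false.
Proof.
by have := cocycleM 1 1 t; rewrite mulg1 invg1 mul1g mulg1; case: (cocycle 1 t).
Qed.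

(** For t = x s x^-1, the contributions of x and x^-1 add up to the cocycle of 1 and cancel, leaving
    that of the middle letter s at s. *)
Lemma cocycle_refl t : reflection S t -> cocycle t t.
Proof.
move=> [x [s [Ss tE]]].
have E : x^-1 * t * x = s by rewrite tE !mulgA mulVg mul1g mulgVK.
have := cocycleM x x^-1 t; rewrite mulgV cocycle1 E => /esym xs.
rewrite {1}tE -mulgA !cocycleM E (cocycle_s _ Ss) eqxx mulVg mul1g.
by case: (cocycle x t) xs; case: (cocycle _ s).
Qed.

Lemma refl_mul t : reflection S t -> t * t = 1.
Proof.
by move=> [x [s [Ss ->]]]; rewrite !mulgA mulgVK -(mulgA x) gen_mul // mulg1 mulgV.
Qed.

(** Strong exchange: the cocycle of a word is a sum modulo 2 over its letters, so if it is true,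
    some letter contributes; multiplying by [t] deletes that letter. *)
Lemma cocycle_exchange (r : seq W) t : (forall s, s \in r -> S s) ->
  cocycle (\prod_(s <- r) s) t -> exists r1 s r2,
    r = r1 ++ s :: r2 /\ t * \prod_(u <- r) u = \prod_(u <- r1 ++ r2) u.
Proof.
elim: r t => [|s r IH] t Sr; first by rewrite big_nil cocycle1.
have Ss : S s by apply: Sr; rewrite mem_head.
rewrite big_cons cocycleM (cocycle_s _ Ss); case: eqP => [-> _|_ /=].
  by exists [::], s, r; rewrite genK.
move=> /IH[u ur|r1 [u [r2 [-> E]]]].
  by apply: Sr; rewrite in_cons ur orbT.
exists (s :: r1), u, r2; split=> //.
by rewrite cat_cons big_cons -E !mulgA mulgV mul1g.
Qed.

Lemma len_cocycle w t : cocycle w t -> (len S (t * w) < len S w)%N.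
Proof.
have [r [<- Sr <-]] := len_word w.
move=> /(cocycle_exchange Sr)[r1 [s [r2 [rE ->]]]].
apply: (leq_ltn_trans (len_le _)).
  move=> u; rewrite mem_cat => ur; apply: Sr.
  by rewrite rE mem_cat in_cons orbCA ur orbT.
by rewrite rE !size_cat /= addnS.
Qed.

(** If the cocycle of [w] is false at [t], then that of [t * w] is true there by [cocycle_refl], so
    multiplying [t * w] by [t] shortens it. *)
Lemma len_refl w t : reflection S t ->
  (len S (t * w) < len S w)%N = cocycle w t.
Proof.
move=> tR; case: (boolP (cocycle w t)) => [/len_cocycle //|Nwt].
apply/negbTE; rewrite -leqNgt ltnW // -[X in (len S X < _)%N](mulKg t).
have -> : t^-1 = t by rewrite -[LHS]mulg1 -(refl_mul tR) mulKg.
apply: len_cocycle; rewrite cocycleM cocycle_refl //= mulVg mul1g.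
exact: Nwt.
Qed.

Lemma gen_reflection s : S s -> reflection S s.
Proof. by move=> Ss; exists 1, s; rewrite mul1g invg1 mulg1. Qed.

(** The cocycles of [w] and [s * w] differ at [s], whereas equal lengths would make both false. *)
Lemma len_neq s w : S s -> len S (s * w) <> len S w.
Proof.
move=> Ss E; have := len_refl w (gen_reflection Ss).
have := len_refl (s * w) (gen_reflection Ss).
rewrite genK // E ltnn => N1 N2; move: N1.
by rewrite cocycleM (cocycle_s _ Ss) eqxx mulVg mul1g -N2.
Qed.

Lemma len_mulsP s w : S s ->
  len S (s * w) = (len S w).+1 \/ len S w = (len S (s * w)).+1.
Proof.
move=> Ss; have := len_mul s w; have := len_mul s (s * w).
by have := @len_neq s w Ss; rewrite (genK _ Ss) (len_gen Ss); lia.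
Qed.

Lemma len_mulVs s w : S s -> len S (w^-1 * s) = len S (s * w).
Proof. by move=> Ss; rewrite -len_inv invgM invgK gen_inv. Qed.

Lemma len_left w : w <> 1 ->
  exists s w', [/\ S s, w = s * w' & len S w = (len S w').+1].
Proof.
have [[|s r] [lw Sr wE]] := len_word w; rewrite -{1}wE.
  by rewrite big_nil.
move=> _; have Ss : S s by apply: Sr; rewrite mem_head.
have [w' wE' lw'] : exists2 w', s * w' = w & (len S w' <= size r)%N.
  exists (\prod_(u <- r) u); first by rewrite -wE big_cons.
  by apply: len_le => u ur; apply: Sr; rewrite in_cons ur orbT.
exists s, w'; split=> //; have := len_mulsP w' Ss.
by rewrite wE'; move: lw => /=; lia.
Qed.

Lemma len_ind (Q : W -> Prop) : Q 1 ->
  (forall s w, S s -> len S (s * w) = (len S w).+1 -> Q w -> Q (s * w)) ->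
  forall w, Q w.
Proof.
move=> Q1 Qs w; have [n] := ubnP (len S w); elim: n w => // n IH w.
have [->//|w1] := pselect (w = 1).
have [s [w' [Ss -> lw]]] := len_left w1; rewrite lw ltnS => lt.
by apply: Qs => //; apply: IH.
Qed.

Lemma len_ind_r (Q : W -> Prop) : Q 1 ->
  (forall w s, S s -> len S (w * s) = (len S w).+1 -> Q w -> Q (w * s)) ->
  forall w, Q w.
Proof.
move=> Q1 Qs w; rewrite -[w]invgK; move: w^-1; apply: len_ind.
  by rewrite invg1.
move=> s x Ss lx Qx; rewrite invgM (gen_inv Ss); apply: Qs => //.
by rewrite len_mulVs // len_inv.
Qed.

(** When prepending a letter lowers the length, exchange deletes a letter of the word already built,
    so no letter outside [J] is introduced. *)
Lemma generated_reduced (J : set W) (w : W) : J `<=` S -> generated J w ->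
  exists2 r, (forall s, s \in r -> J s) &
    \prod_(s <- r) s = w /\ size r = len S w.
Proof.
move=> JS /(generated_word JS)[r + <-] {w}.
elim: r => [_|s r IH Jr]; first by exists [::]; rewrite ?big_nil ?len1.
have [|r' Jr' [r'E sr']] := IH.
  by move=> t tr; apply: Jr; rewrite in_cons tr orbT.
have Js : J s by apply: Jr; rewrite mem_head.
rewrite big_cons -r'E; have [l1|l2] := len_mulsP (\prod_(u <- r') u) (JS _ Js).
  exists (s :: r'); last by rewrite big_cons l1 /= sr' r'E.
  by move=> t /[!inE] /orP[/eqP ->//|/Jr'].
have Nr : cocycle (\prod_(u <- r') u) s.
  by rewrite -len_refl ?l2 //; apply/gen_reflection/JS.
have [|r1 [t [r2 [rE pE]]]] := cocycle_exchange _ Nr.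
  by move=> u /Jr' /JS.
exists (r1 ++ r2).
  by move=> u; rewrite mem_cat => ur; apply: Jr'; rewrite rE mem_cat inE orbCA ur orbT.
rewrite -pE; split=> //; apply: succn_inj; rewrite -l2 r'E -sr' rE !size_cat /=.
by rewrite addnS.
Qed.

Lemma bruhat_len y w : bruhat S y w -> y = w \/ (len S y < len S w)%N.
Proof.
elim=> [x z [_ lt]|x|x y' z _ IH1 _ IH2]; [by right|by left|].
by case: IH1 => [->|lt1] //; case: IH2 => [<-|/(ltn_trans lt1)]; right.
Qed.

Lemma bruhat_last y w : bruhat S y w -> y = w \/
  exists2 z, bruhat S y z &
    (exists2 t, reflection S t & w = z * t) /\ (len S z < len S w)%N.
Proof.
move=> /clos_rt_rtn1_iff; case=> [|z z' zz' yz]; first by left.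
by right; exists z => //; apply/clos_rt_rtn1_iff.
Qed.

(* By strong exchange [w] covers finitely many elements, one per letter of a
   reduced word. *)
Lemma finite_bruhat w : finite_set [set y | bruhat S y w].
Proof.
have [n] := ubnP (len S w); elim: n w => // n IH w ltn.
have [r [_ Sr rE]] := len_word w.
pose L := [seq \prod_(u <- take i r ++ drop i.+1 r) u | i <- iota 0 (size r)].
pose low := [set z | z \in L /\ (len S z < len S w)%N].
apply: (@sub_finite_set _ _ ([set w] `|` \bigcup_(z in low) [set y | bruhat S y z])).
  move=> y /bruhat_last[->|[z yz [[t tR wE] lt]]]; first by left.
  right; exists z => //; split=> //.
  (* Bruhat steps multiply by a reflection on the right, exchange on the left; conjugation by [w]
     passes from one to the other. *)
  have zE : z = (w * t * w^-1) * w.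
    by rewrite mulgVK wE -mulgA (refl_mul tR) mulg1.
  have t'R : reflection S (w * t * w^-1).
    have [x [s [Ss ->]]] := tR; exists (w * x), s; split=> //.
    by rewrite invgM !mulgA.
  have := len_refl w t'R; rewrite -zE lt => /esym; rewrite -rE.
  move=> /(cocycle_exchange Sr)[r1 [s [r2 [rE' pE]]]].
  apply/mapP; exists (size r1).
    by rewrite mem_iota rE' size_cat /= addnS ltnS leq_addr.
  rewrite zE -rE pE rE' take_size_cat // -cat_rcons drop_size_cat //.
  by rewrite size_rcons.
rewrite finite_setU; split; first exact: finite_set1.
apply: bigcup_finite.
  apply: (@sub_finite_set _ _ [set` L]); last exact: finite_seq.
  by move=> z [].
by move=> z [_ lt]; apply: IH; apply: leq_trans lt ltn.
Qed.

End CoxeterLength.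

(** * Degrees and leading coefficients of Laurent polynomials *)

Section LaurentDegree.
Local Notation "x %:F" := (@FracField.tofrac _ x).
Implicit Types (f g : laurent) (p r : {poly int}) (n m : nat) (k j : int).

Definition fraction_of f n p := laurent_val f * Xfrac ^+ n = p%:F.

(** Since [size p] is the degree plus one, this says deg p - n <= k. Zero satisfies every bound,
    because n may be enlarged. *)
Definition deg_le f k := exists n p,
  fraction_of f n p /\ (size p)%:Z <= k + n%:Z + 1.

Definition lead_nonneg f := exists n p, fraction_of f n p /\ 0 <= lead_coef p.

(** The coefficient in the normalized quadratic relation T~_s^2 = 1 + xi T~_s; it has degree exactly
    1 and leading coefficient 1. *)
Definition xi : laurent := qhalf 1 - qhalf (-1).

Lemma laurent_valD f g : laurent_val (f + g) = laurent_val f + laurent_val g.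
Proof. by []. Qed.

Lemma laurent_valN f : laurent_val (- f) = - laurent_val f.
Proof. by []. Qed.

Lemma laurent_valM f g : laurent_val (f * g) = laurent_val f * laurent_val g.
Proof. by []. Qed.

Lemma laurent_val1 : laurent_val 1 = 1.
Proof. by []. Qed.

Lemma laurent_val0 : laurent_val 0 = 0.
Proof. by []. Qed.

Lemma laurent_val_inj : injective laurent_val.
Proof. exact: val_inj. Qed.

Lemma Xfrac_neq0 : Xfrac != 0.
Proof. by rewrite tofrac_eq0 polyX_eq0. Qed.

Lemma fraction_of_ex f : exists n p, fraction_of f n p.
Proof. by have /asboolP[p [n fE]] := laurent_valP f; exists n, p. Qed.

Lemma fraction_of_shift f n m p :
  fraction_of f n p -> fraction_of f (n + m) (p * 'X^m).
Proof. by rewrite /fraction_of exprD mulrA tofracM tofracXn => ->. Qed.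

Lemma fraction_of_inj f n p r : fraction_of f n p -> fraction_of f n r -> p = r.
Proof. by rewrite /fraction_of => -> /eqP; rewrite tofrac_eq => /eqP. Qed.

Lemma fraction_ofD f g n p r :
  fraction_of f n p -> fraction_of g n r -> fraction_of (f + g) n (p + r).
Proof. by rewrite /fraction_of laurent_valD mulrDl tofracD => -> ->. Qed.

Lemma fraction_ofN f n p : fraction_of f n p -> fraction_of (- f) n (- p).
Proof. by rewrite /fraction_of laurent_valN mulNr tofracN => ->. Qed.

Lemma fraction_ofM f g n m p r : fraction_of f n p -> fraction_of g m r ->
  fraction_of (f * g) (n + m) (p * r).
Proof. by rewrite /fraction_of laurent_valM exprD mulrACA tofracM => -> ->. Qed.

Lemma fraction_of1 : fraction_of 1 0 1.
Proof. by rewrite /fraction_of laurent_val1 mulr1 tofrac1. Qed.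

Lemma fraction_of0 n : fraction_of 0 n 0.
Proof. by rewrite /fraction_of laurent_val0 mul0r tofrac0. Qed.

Lemma fraction_of_eq0 f n p : fraction_of f n p -> (p == 0) = (f == 0).
Proof.
move=> fE; rewrite -tofrac_eq0 -fE mulf_eq0.
rewrite expf_eq0 (negbTE Xfrac_neq0) andbF orbF.
apply/eqP/eqP => [f0|->]; last exact: laurent_val0.
by apply: laurent_val_inj; rewrite f0 laurent_val0.
Qed.

Lemma fraction_of_common f g : exists n p r, fraction_of f n p /\ fraction_of g n r.
Proof.
have [n [p fE]] := fraction_of_ex f; have [m [r gE]] := fraction_of_ex g.
exists (n + m)%N, (p * 'X^m), (r * 'X^n); split; first exact: fraction_of_shift.
by rewrite addnC; exact: fraction_of_shift.
Qed.

(** The bound can be tested on any given fraction; p = 0 is a separate case because the inequality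
    on sizes may fail for this particular n. *)
Lemma deg_leP f k n p : fraction_of f n p ->
  deg_le f k <-> p = 0 \/ (size p)%:Z <= k + n%:Z + 1.
Proof.
move=> fE; split=> [[m [r [fE' kr]]]|[p0|]]; last by exists n, p.
- have rp : r * 'X^n = p * 'X^m.
    apply: (@fraction_of_inj f (n + m)%N); last exact: fraction_of_shift.
    by rewrite addnC; exact: fraction_of_shift.
  have [->|p0] := eqVneq p 0; [by left|right].
  have r0 : r != 0 by rewrite (fraction_of_eq0 fE') -(fraction_of_eq0 fE).
  have := congr1 (fun s : {poly int} => size s) rp.
  rewrite !size_mulXn //; lia.
(* For zero, the denominator exponent is raised by |k|, so that the inequality holds for negative k
   as well. *)
- exists (n + `|k|)%N, 0; split; last by rewrite size_poly0; lia.
  by rewrite -[X in fraction_of _ _ X](mul0r 'X^`|k|%N) -p0; exact: fraction_of_shift.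
Qed.

Lemma deg_le0 k : deg_le 0 k.
Proof. by apply/(deg_leP _ (fraction_of0 0)); left. Qed.

Lemma deg_leW f k j : k <= j -> deg_le f k -> deg_le f j.
Proof. by move=> kj [n [p [fE pk]]]; exists n, p; split=> //; lia. Qed.

Lemma deg_leD f g k : deg_le f k -> deg_le g k -> deg_le (f + g) k.
Proof.
have [n [p [r [fE gE]]]] := fraction_of_common f g.
move=> /(deg_leP _ fE) fk /(deg_leP _ gE) gk; apply/(deg_leP _ (fraction_ofD fE gE)).
have := size_polyD p r; case: fk => [->|fk]; first by rewrite add0r.
case: gk => [->|gk]; first by rewrite addr0; right.
by right; lia.
Qed.

Lemma deg_leN f k : deg_le f k -> deg_le (- f) k.
Proof.
move=> [n [p [fE pk]]]; exists n, (- p); rewrite size_polyN; split=> //.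
exact: fraction_ofN.
Qed.

Lemma deg_leB f g k : deg_le f k -> deg_le g k -> deg_le (f - g) k.
Proof. by move=> fk gk; apply: deg_leD fk (deg_leN gk). Qed.

Lemma deg_le_sum (I : Type) (s : seq I) (Q : pred I) (F : I -> laurent) k :
  (forall i, Q i -> deg_le (F i) k) -> deg_le (\sum_(i <- s | Q i) F i) k.
Proof.
move=> H; elim/big_ind: _ => //; [exact: deg_le0|by move=> ? ?; exact: deg_leD].
Qed.

Lemma deg_leM f g k j : deg_le f k -> deg_le g j -> deg_le (f * g) (k + j).
Proof.
move=> [n [p [fE pk]]] [m [r [gE rj]]].
apply/(deg_leP _ (fraction_ofM fE gE)).
have [->|p0] := eqVneq p 0; first by rewrite mul0r; left.
have [->|r0] := eqVneq r 0; first by rewrite mulr0; left.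
right; rewrite size_mul //; move: p0 r0; rewrite -!size_poly_gt0.
by move: (size p) (size r) pk rj => a b; lia.
Qed.

Lemma deg_le1 k : deg_le 1 k <-> 0 <= k.
Proof.
rewrite (deg_leP _ fraction_of1) size_poly1; split=> [[/eqP|]|k0].
- by rewrite oner_eq0.
- by lia.
- by right; lia.
Qed.

Lemma qhalfD k j : qhalf (k + j) = qhalf k * qhalf j.
Proof. by apply: laurent_val_inj; rewrite laurent_valM /= expfzDr ?Xfrac_neq0. Qed.

Lemma qhalf0 : qhalf 0 = 1.
Proof. by apply: laurent_val_inj; rewrite laurent_val1. Qed.

Lemma qhalfV k : qhalf k * qhalf (- k) = 1.
Proof. by rewrite -qhalfD subrr qhalf0. Qed.

Lemma deg_le_qhalf k : deg_le (qhalf k) k.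
Proof.
case: k => n.
  exists 0%N, 'X^n; split; last by rewrite size_polyXn; lia.
  by rewrite /fraction_of mulr1 /= tofracXn.
exists n.+1, 1; split; last by rewrite size_poly1; lia.
by rewrite /fraction_of /= -[_ ^ _]/(Xfrac ^- n.+1) mulVf ?expf_neq0 ?Xfrac_neq0 ?tofrac1.
Qed.

Lemma fraction_of_int (z : int) : fraction_of z%:~R 0 z%:P.
Proof.
have natE (n : nat) : fraction_of n%:R 0 n%:R.
  elim: n => [|n IH]; first exact: fraction_of0.
  by rewrite -!(addn1 n) !natrD; apply: fraction_ofD IH fraction_of1.
have polyE (n : nat) : (n%:Z)%:P = n%:R :> {poly int} by rewrite -natz polyC_natr.
case: z => n; first by rewrite polyE -pmulrn; exact: natE.
rewrite NegzE mulrNz polyCN; apply: fraction_ofN.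
by rewrite polyE -pmulrn; exact: natE.
Qed.

Lemma deg_le_int (z : int) : deg_le z%:~R 0.
Proof.
exists 0%N, z%:P; split; first exact: fraction_of_int.
by have := size_polyC_leq1 z; move: (size _) => a; lia.
Qed.

Lemma qhalf_exp (k : int) n : qhalf k ^+ n = qhalf (k * n%:Z).
Proof.
elim: n => [|n IH]; first by rewrite mulr0 qhalf0.
by rewrite exprS IH -qhalfD -addn1 PoszD; congr qhalf; ring.
Qed.

Lemma deg_le_eval_q p k : 0 <= k -> (size p).-1.*2%:Z <= k -> deg_le (eval_q p) k.
Proof.
move=> k0 pk; rewrite /eval_q horner_coef; apply: deg_le_sum => i _.
rewrite coef_map /= qhalf_exp -[k]add0r; apply: deg_leM; first exact: deg_le_int.
apply: deg_leW (deg_le_qhalf _).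
have lt := leq_trans (ltn_ord i) (size_poly _ _).
by move: pk lt; move: (size p) (nat_of_ord i) => a b; lia.
Qed.

Lemma eval_q1 : eval_q 1 = 1.
Proof. by rewrite /eval_q rmorph1 hornerE. Qed.

Lemma eval_q0 : eval_q 0 = 0.
Proof. by rewrite /eval_q rmorph0 hornerE. Qed.

Lemma has_degree_ex f : f != 0 -> exists i, has_degree f i.
Proof.
have [n [p fE]] := fraction_of_ex f => f0.
by exists ((size p).-1%:Z - n%:Z), p, n; rewrite (fraction_of_eq0 fE).
Qed.

Lemma has_degree_le f i : has_degree f i -> deg_le f i.
Proof.
move=> [p [n [p0 fE ->]]]; exists n, p; split=> //.
by move: (size p) => a; lia.
Qed.

Lemma has_degree_gt f i : has_degree f i -> ~ deg_le f (i - 1).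
Proof.
move=> [p [n [p0 fE ->]]] /(deg_leP _ fE)[/eqP|]; first by rewrite (negbTE p0).
by move: p0; rewrite -size_poly_gt0; move: (size p) => a; lia.
Qed.

Lemma lead_nonneg0 : lead_nonneg 0.
Proof. by exists 0%N, 0; split; [exact: fraction_of0|rewrite lead_coef0]. Qed.

Lemma lead_nonneg1 : lead_nonneg 1.
Proof. by exists 0%N, 1; split; [exact: fraction_of1|rewrite lead_coef1]. Qed.

Lemma lead_nonnegP f n p :
  fraction_of f n p -> lead_nonneg f <-> 0 <= lead_coef p.
Proof.
move=> fE; split=> [[m [r [fE' r0]]]|]; last by exists n, p.
have rp : r * 'X^n = p * 'X^m.
  apply: (@fraction_of_inj f (n + m)%N); last exact: fraction_of_shift.
  by rewrite addnC; exact: fraction_of_shift.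
by move: (congr1 lead_coef rp); rewrite !lead_coef_Mmonic ?monicXn // => <-.
Qed.

(** In equal sizes the two leading coefficients add up to a positive number unless both polynomials
    vanish, so nothing cancels. *)
Lemma lead_coefD_nonneg p r : 0 <= lead_coef p -> 0 <= lead_coef r ->
  0 <= lead_coef (p + r) /\ size (p + r) = maxn (size p) (size r).
Proof.
move=> p0 r0; have [lt|lt|E] := ltngtP (size p) (size r).
- by rewrite addrC lead_coefDl // size_polyDl //.
- by rewrite lead_coefDl // size_polyDl.
have [p00|pn0] := eqVneq p 0.
  by move: E; rewrite p00 add0r size_poly0 => <-.
have r_gt0 : (0 < size r)%N by rewrite -E size_poly_gt0.
have lt0 : 0 < p`_(size r).-1 + r`_(size r).-1.
  by rewrite ltr_pwDl // -E lt_neqAle p0 eq_sym lead_coef_eq0 pn0.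
have sE : size (p + r) = size r.
  apply/eqP; rewrite eqn_leq (leq_trans (size_polyD _ _)) ?E ?maxnn //=.
  rewrite leqNgt; apply/negP => lt; move: lt0; rewrite -coefD nth_default ?ltxx //.
  by move: r_gt0 lt; move: (size r) (size (p + r)) => a b; lia.
by rewrite sE; split=> //; rewrite lead_coefE sE coefD ltW.
Qed.

Lemma lead_nonnegD f g : lead_nonneg f -> lead_nonneg g -> lead_nonneg (f + g).
Proof.
have [n [p [r [fE gE]]]] := fraction_of_common f g.
move=> /(lead_nonnegP fE) p0 /(lead_nonnegP gE) r0.
by apply/(lead_nonnegP (fraction_ofD fE gE)); have [] := lead_coefD_nonneg p0 r0.
Qed.

(** As leading terms do not cancel, a bound on a sum bounds its summands. This lets one term of a
    recursion witness the top degree. *)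
Lemma lead_nonneg_deg_leD f g k : lead_nonneg f -> lead_nonneg g ->
  deg_le (f + g) k -> deg_le f k.
Proof.
have [n [p [r [fE gE]]]] := fraction_of_common f g.
move=> /(lead_nonnegP fE) p0 /(lead_nonnegP gE) r0.
have [_ sE] := lead_coefD_nonneg p0 r0.
move=> /(deg_leP _ (fraction_ofD fE gE))[/(congr1 (fun s : {poly int} => size s))|].
  rewrite sE size_poly0 => /eqP; rewrite -leqn0 geq_max !leqn0 size_poly_eq0.
  by case/andP => /eqP p00 _; apply/(deg_leP _ fE); left.
rewrite sE => H; apply/(deg_leP _ fE); right; move: H.
by move: (size p) (size r) => a b; lia.
Qed.

Lemma fraction_of_xi : fraction_of xi 1 ('X^2 - 1).
Proof.
rewrite /fraction_of laurent_valD laurent_valN /= expr1z -exprnN mulrBl.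
by rewrite mulVf ?Xfrac_neq0 // -expr2 tofracB tofracXn tofrac1.
Qed.

Lemma lead_coef_X2B1 : lead_coef ('X^2 - 1 : {poly int}) = 1 /\
  size ('X^2 - 1 : {poly int}) = 3.
Proof. by rewrite lead_coefXnsubC // size_XnsubC. Qed.

Lemma lead_nonneg_xi f : lead_nonneg f -> lead_nonneg (xi * f).
Proof.
move=> [n [p [fE p0]]]; apply/(lead_nonnegP (fraction_ofM fraction_of_xi fE)).
by rewrite lead_coefM lead_coef_X2B1.1 mul1r.
Qed.

Lemma deg_le_xi f k : deg_le (xi * f) (k + 1) -> deg_le f k.
Proof.
have [n [p fE]] := fraction_of_ex f.
move=> /(deg_leP _ (fraction_ofM fraction_of_xi fE)); rewrite (deg_leP _ fE).
have [->|p0] := eqVneq p 0; first by left.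
rewrite size_mul // -?size_poly_gt0 lead_coef_X2B1.2 //; case=> [/eqP|].
  by rewrite mulf_eq0 -size_poly_eq0 lead_coef_X2B1.2 (negbTE p0).
by move: p0; rewrite -size_poly_gt0; move: (size p) => a; right; lia.
Qed.

End LaurentDegree.

(** * Finitely supported coordinates with respect to a family of vectors *)

Section Coordinates.
Variables (I : choiceType) (A : nzRingType) (M : lmodType A) (B : I -> M).
Implicit Types (x y : M) (c d : I -> A).

Lemma is_coords_seq c (s : {fset I}) : (forall i, i \notin s -> c i = 0) ->
  \sum_(i \in [set: I]) c i *: B i = \sum_(i <- s) c i *: B i.
Proof. by move=> cs; apply: fsbigTE => i /cs ->; rewrite scale0r. Qed.

Lemma is_coordsP c : finite_set [set i | c i != 0] -> exists s : {fset I},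
  (forall i, i \in s <-> c i != 0) /\
  \sum_(i \in [set: I]) c i *: B i = \sum_(i <- s) c i *: B i.
Proof.
move=> cfin; exists (fset_set [set i | c i != 0]).
have sP i : i \in fset_set [set i | c i != 0] <-> c i != 0.
  by rewrite in_fset_set // inE.
by split=> //; apply: is_coords_seq => i; apply: contraNeq => /sP.
Qed.

(** Only indices in the support enter the induction step, so facts known about the support of [x]
    can be used there. *)
Lemma is_coords_ind (Q : M -> Prop) x c : is_coords B x c -> Q 0 ->
  (forall i y, c i != 0 -> Q y -> Q (c i *: B i + y)) -> Q x.
Proof.
move=> [/is_coordsP[s [sP ->]] ->] Q0 QD; rewrite big_seq.
by elim/big_rec: _ => // i y /sP; exact: QD.
Qed.

Lemma is_coords0 : is_coords B 0 (fun=> 0).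
Proof.
split; last by rewrite fsbig1 // => i _; rewrite scale0r.
by apply: (@sub_finite_set _ _ set0) => // i /=; rewrite eqxx.
Qed.

Lemma is_coordsD x y c d : is_coords B x c -> is_coords B y d ->
  is_coords B (x + y) (fun i => c i + d i).
Proof.
move=> [cfin ->] [dfin ->].
have [s [sP _]] := is_coordsP cfin; have [t [tP _]] := is_coordsP dfin.
have c0 i : i \notin (s `|` t)%fset -> c i = 0.
  by rewrite in_fsetU negb_or => /andP[+ _]; apply: contraNeq => /sP.
have d0 i : i \notin (s `|` t)%fset -> d i = 0.
  by rewrite in_fsetU negb_or => /andP[_]; apply: contraNeq => /tP.
split.
  apply: (@sub_finite_set _ _ [set` (s `|` t)%fset]) => [i /=|].
    by apply: contraNT => Ni; rewrite c0 // d0 // addr0.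
  exact: finite_fset.
rewrite !(@is_coords_seq _ (s `|` t)%fset) -?big_split //=.
  by apply: eq_bigr => i _; rewrite scalerDl.
by move=> i Ni; rewrite c0 // d0 // addr0.
Qed.

Lemma is_coordsZ a x c : is_coords B x c -> is_coords B (a *: x) (fun i => a * c i).
Proof.
move=> [cfin ->]; have [s [sP ->]] := is_coordsP cfin.
have c0 i : i \notin s -> c i = 0 by apply: contraNeq => /sP.
split.
  apply: (sub_finite_set _ cfin) => i /=.
  by apply: contra_neq => ->; rewrite mulr0.
rewrite (@is_coords_seq _ s) => [|i /c0 ->]; last by rewrite mulr0.
by rewrite scaler_sumr; apply: eq_bigr => i _; rewrite scalerA.
Qed.

Lemma is_coords_elt j : is_coords B (B j) (fun i => (i == j)%:R).
Proof.
split.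
  apply: (@sub_finite_set _ _ [set j]); last exact: finite_set1.
  by move=> i /=; case: (eqVneq i j) => // _ /eqP.
rewrite (@is_coords_seq _ [fset j]%fset) => [|i].
  by rewrite big_seq_fset1 eqxx scale1r.
by rewrite inE => /negbTE ->.
Qed.

Hypothesis Bbasis : is_basis B.

Lemma coordP x : is_coords B x (coord B x).
Proof. by rewrite /coord; apply: xgetPex; have [c [cx _]] := Bbasis x; exists c. Qed.

Lemma coord_uniq x c : is_coords B x c -> coord B x = c.
Proof.
have [d [dx dU]] := Bbasis x.
by move=> /dU <-; apply/esym/dU/coordP.
Qed.

Lemma coordD x y i : coord B (x + y) i = coord B x i + coord B y i.
Proof. by rewrite (coord_uniq (is_coordsD (coordP x) (coordP y))). Qed.

Lemma coordZ a x i : coord B (a *: x) i = a * coord B x i.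
Proof. by rewrite (coord_uniq (is_coordsZ a (coordP x))). Qed.

Lemma coord0 i : coord B 0 i = 0.
Proof. by rewrite (coord_uniq is_coords0). Qed.

Lemma coord_elt j i : coord B (B j) i = (i == j)%:R.
Proof. by rewrite (coord_uniq (is_coords_elt j)). Qed.

Lemma basis_ind (Q : M -> Prop) : Q 0 ->
  (forall a i y, Q y -> Q (a *: B i + y)) -> forall x, Q x.
Proof. by move=> Q0 QD x; apply: (is_coords_ind (coordP x)) => // i y _; apply: QD. Qed.

End Coordinates.

(** * The normalized standard basis, its trace form and its structure constants *)

Section StandardBasis.
Variables (W : groupType) (S : set W).
Hypothesis HS : coxeter_system S.
Variables (H : algType laurent) (T : W -> H).
Hypothesis HT : hecke_algebra S T.
Implicit Types (w x y z s : W) (u v : H) (a : laurent).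

Local Notation len := (len S).

Definition norm_T w : H := locked (qhalf (- (len w)%:Z) *: T w).

Local Notation Tt := norm_T.

Lemma TtE w : Tt w = qhalf (- (len w)%:Z) *: T w.
Proof. by rewrite /norm_T -lock. Qed.

(** As T_w = q^(l(w)/2) T~_w, this is the coordinate with respect to the normalized basis. *)
Definition norm_coord u w : laurent := qhalf (len w)%:Z * coord T u w.

Local Notation tco := norm_coord.

Lemma T_basis : is_basis T. Proof. by case: HT. Qed.

Lemma T_mul w x : len (w * x)%g = (len w + len x)%N -> T w * T x = T (w * x)%g.
Proof. by case: HT => _ _; apply. Qed.

Lemma Tt_scale w : qhalf (len w)%:Z *: Tt w = T w.
Proof. by rewrite TtE scalerA qhalfV scale1r. Qed.

Lemma is_coords_tco u : is_coords Tt u (tco u).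
Proof.
have [fin uE] := coordP T_basis u; split.
  apply: (sub_finite_set _ fin) => w /=; apply: contra_neq => E.
  by rewrite /norm_coord E mulr0.
rewrite [LHS]uE; apply: eq_fsbigr => w _.
by rewrite /norm_coord mulrC -scalerA Tt_scale.
Qed.

Lemma tcoD u v w : tco (u + v) w = tco u w + tco v w.
Proof. by rewrite /norm_coord (coordD T_basis) mulrDr. Qed.

Lemma tcoZ a u w : tco (a *: u) w = a * tco u w.
Proof. by rewrite /norm_coord (coordZ T_basis) mulrCA. Qed.

Lemma tco0 w : tco 0 w = 0.
Proof. by rewrite /norm_coord (coord0 T_basis) mulr0. Qed.

Lemma tcoB u v w : tco (u - v) w = tco u w - tco v w.
Proof. by rewrite tcoD -scaleN1r tcoZ mulN1r. Qed.

Lemma tco_Tt w z : tco (Tt w) z = (z == w)%:R.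
Proof.
rewrite TtE tcoZ /norm_coord (coord_elt T_basis); case: eqVneq => [->|_].
  by rewrite mulr1 mulrC qhalfV.
by rewrite !mulr0.
Qed.

Lemma Tt_ind (Q : H -> Prop) : Q 0 ->
  (forall a w u, Q u -> Q (a *: Tt w + u)) -> forall u, Q u.
Proof.
by move=> Q0 QD u; apply: (is_coords_ind (is_coords_tco u)) => // w v _; apply: QD.
Qed.

(** Lengths add in the product of 1 and w, so [T 1] is a left identity on the basis, hence on
    [H]. *)
Lemma T_1 : T 1%g = 1.
Proof.
have T1u u : T 1%g * u = u.
  move: u; apply: (basis_ind T_basis) => [|a w u IH]; first by rewrite mulr0.
  by rewrite mulrDr IH -scalerAr T_mul ?mul1g ?(len1 HS).
by rewrite -[LHS]mulr1 T1u.
Qed.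

Lemma Tt_1 : Tt 1%g = 1.
Proof. by rewrite TtE len1 // oppr0 qhalf0 scale1r T_1. Qed.

Lemma Tt_mul w x : len (w * x)%g = (len w + len x)%N -> Tt w * Tt x = Tt (w * x)%g.
Proof.
move=> lwx; rewrite !TtE -scalerAl -scalerAr scalerA T_mul // lwx -qhalfD.
by congr (qhalf _ *: _); rewrite PoszD opprD.
Qed.

Lemma Tt_sq s : S s -> Tt s * Tt s = 1 + xi *: Tt s.
Proof.
move=> Ss; case: HT => _ /(_ s Ss) + _.
rewrite mulrBl mulrDr mulr1 -scalerAl mul1r => /eqP.
rewrite subr_eq0 => /eqP /(canRL (addrK _)) Tss.
rewrite !TtE len_gen // -scalerAl -scalerAr Tss.
have aaq : qhalf (-1) * (qhalf (-1) * q) = 1 by rewrite /q -!qhalfD qhalf0.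
have xia : xi * qhalf (-1) = 1 - qhalf (-1) * qhalf (-1).
  by rewrite /xi mulrBl -(qhalfD 1) qhalf0.
rewrite !scalerBr !scalerA -mulrA aaq scale1r xia scalerBl scale1r.
by rewrite [T s + 1]addrC addrA.
Qed.

Lemma Tt_gen_mul s w : S s -> len w = (len (s * w)%g).+1 ->
  Tt s * Tt w = Tt (s * w)%g + xi *: Tt w.
Proof.
move=> Ss lw; have E : Tt w = Tt s * Tt (s * w)%g.
  by rewrite Tt_mul (genK HS) // lw (len_gen HS Ss).
by rewrite {1}E mulrA Tt_sq // mulrDl mul1r -scalerAl -E.
Qed.

Lemma Tt_mul_gen s w : S s -> len w = (len (w * s)%g).+1 ->
  Tt w * Tt s = Tt (w * s)%g + xi *: Tt w.
Proof.
move=> Ss lw; have wss : (w * s * s)%g = w by rewrite -mulgA (gen_mul HS) // mulg1.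
have E : Tt w = Tt (w * s)%g * Tt s.
  by rewrite Tt_mul ?wss // lw (len_gen HS Ss) addn1.
by rewrite {1}E -mulrA Tt_sq // mulrDr mulr1 -scalerAr -E.
Qed.

(* (T~_w) and (T~_(w^-1)) are dual bases for (u, v) |-> tau (u * v). *)
Definition tau u := tco u 1%g.

Lemma tauD u v : tau (u + v) = tau u + tau v. Proof. exact: tcoD. Qed.

Lemma tauZ a u : tau (a *: u) = a * tau u. Proof. exact: tcoZ. Qed.

Lemma tau_Tt x y : tau (Tt x * Tt y) = (x * y == 1)%g%:R.
Proof.
move: x y; apply: (len_ind_r HS) => [y|x s Ss lx IH y].
  by rewrite Tt_1 mul1r /tau tco_Tt mul1g eq_sym.
rewrite -Tt_mul ?lx ?(len_gen HS Ss) ?addn1 // -mulrA -mulgA.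
have [ly|ly] := len_mulsP HS y Ss.
  by rewrite Tt_mul ?ly ?(len_gen HS Ss).
rewrite Tt_gen_mul // mulrDr -scalerAr tauD tauZ !IH.
(* The extra term vanishes: x y = 1 would make s lengthen x = y^-1 on the right while it shortens y
   on the left. *)
case: (eqVneq (x * y)%g 1%g) => [xy|_]; last by rewrite mulr0 addr0.
have xE : x = (y^-1)%g by rewrite -[x]mulg1 -(mulgV y) mulgA xy mul1g.
by move: lx; rewrite xE (len_mulVs HS) // (len_inv HS) ly; lia.
Qed.

(** By bilinearity this reduces to basis elements, for which x y = 1 and y x = 1 are equivalent. *)
Lemma tauC u v : tau (u * v) = tau (v * u).
Proof.
move: u; apply: Tt_ind => [|a x u IH]; first by rewrite mul0r mulr0.
rewrite mulrDl mulrDr !tauD IH -scalerAl -scalerAr !tauZ; congr (_ * _ + _).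
move: v {IH}; apply: Tt_ind => [|b y v IH]; first by rewrite mul0r mulr0.
rewrite mulrDl mulrDr !tauD IH -scalerAl -scalerAr !tauZ !tau_Tt.
by rewrite !mulg_eq1 -eqg_invLR eq_sym.
Qed.

Lemma tco_tau u z : tco u z = tau (u * Tt z^-1%g).
Proof.
move: u; apply: Tt_ind => [|a x u IH]; first by rewrite mul0r /tau !tco0.
rewrite mulrDl tauD -scalerAl tauZ tau_Tt tcoD tcoZ tco_Tt IH.
by rewrite divg_eq1 eq_sym.
Qed.

Definition struct_const x y z := tco (Tt x * Tt y) z.

Local Notation f := struct_const.

Lemma f_tau x y z : f x y z^-1%g = tau (Tt x * Tt y * Tt z).
Proof. by rewrite /struct_const tco_tau invgK. Qed.

Lemma f_cyclic x y z : f x y z^-1%g = f y z x^-1%g.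
Proof. by rewrite !f_tau -mulrA tauC. Qed.

(** Invariance of the trace under the anti-automorphism T~_w -> T~_(w^-1), proved on triple products
    by moving the letters of x one by one into y, on both sides at once. *)
Lemma tau_inv x y z :
  tau (Tt x * Tt y * Tt z) = tau (Tt z^-1%g * Tt y^-1%g * Tt x^-1%g).
Proof.
move: x y z; apply: (len_ind_r HS) => [y z|x s Ss lx IH y z].
  by rewrite invg1 Tt_1 mul1r mulr1 !tau_Tt -invgM invg_eq1.
have ls := len_gen HS Ss.
rewrite -Tt_mul ?lx ?ls ?addn1 // invgM (gen_inv HS Ss).
rewrite -[Tt (s * _)%g]Tt_mul; last first.
  by rewrite -[(s * _)%g]invgK (len_inv HS) invgM invgK (gen_inv HS Ss) lx (len_inv HS) ls.
rewrite -(mulrA (Tt x)) (mulrA _ (Tt s) (Tt x^-1%g)) -(mulrA (Tt z^-1%g)).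
have sy : (y^-1 * s = (s * y)^-1)%g by rewrite invgM (gen_inv HS Ss).
have [ly|ly] := len_mulsP HS y Ss.
  rewrite (@Tt_mul s y) ?(@Tt_mul y^-1%g s) ?(len_inv HS) ?(len_mulVs HS) ?ly ?ls ?addn1 //.
  by rewrite sy IH.
rewrite Tt_gen_mul // Tt_mul_gen ?(len_inv HS) ?(len_mulVs HS) //.
by rewrite mulrDr !mulrDl mulrDr !mulrDl -!scalerAr -!scalerAl !tauD !tauZ !IH sy.
Qed.

Lemma f_inv x y z : f x y z^-1%g = f y^-1%g x^-1%g z.
Proof. by rewrite f_tau tau_inv -mulrA tauC -f_tau invgK. Qed.

(** Together with [f_gen_down] this computes all structure constants by moving the letters of the
    first factor onto the second. *)
Lemma f_gen_up s x y z : S s -> len (x * s)%g = (len x).+1 ->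
  len (s * y)%g = (len y).+1 -> f (x * s)%g y z = f x (s * y)%g z.
Proof.
move=> Ss lx ly; rewrite /struct_const -Tt_mul ?lx ?(len_gen HS Ss) ?addn1 // -mulrA.
by rewrite Tt_mul ?ly ?(len_gen HS Ss).
Qed.

Lemma f_gen_down s x y z : S s -> len (x * s)%g = (len x).+1 ->
  len y = (len (s * y)%g).+1 ->
  f (x * s)%g y z = f x (s * y)%g z + xi * f x y z.
Proof.
move=> Ss lx ly; rewrite /struct_const -Tt_mul ?lx ?(len_gen HS Ss) ?addn1 // -mulrA.
by rewrite Tt_gen_mul // mulrDr -scalerAr tcoD tcoZ.
Qed.

(** The recursion only adds terms and multiplies by [xi], and both operations preserve nonnegative
    leading coefficients. *)
Lemma f_nonneg x y z : lead_nonneg (f x y z).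
Proof.
move: x y; apply: (len_ind_r HS) => [y|x s Ss lx IH y].
  rewrite /struct_const Tt_1 mul1r tco_Tt; case: (_ == _).
    exact: lead_nonneg1.
  exact: lead_nonneg0.
have [ly|ly] := len_mulsP HS y Ss; first by rewrite f_gen_up.
by rewrite f_gen_down //; apply: lead_nonnegD => //; apply: lead_nonneg_xi.
Qed.

(** By the trace property, T~_s moves to the right of the dual basis element T~_(z^-1), where s is a
    descent. *)
Lemma tco_gen_mul s u z : S s -> len z = (len (s * z)%g).+1 ->
  tco (Tt s * u) z = tco u (s * z)%g + xi * tco u z.
Proof.
move=> Ss lz; rewrite tco_tau -mulrA tauC -mulrA Tt_mul_gen //; last first.
  by rewrite (len_inv HS) (len_mulVs HS).
rewrite mulrDr -scalerAr tauD tauZ -tco_tau; congr (_ + _).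
by rewrite tco_tau invgM (gen_inv HS Ss).
Qed.

(* Each letter of [r] multiplies the coefficient at T~_v by [xi], up to terms with
   nonnegative leading coefficient. *)
Lemma f_lower (r : seq W) (v : W) : (forall s, s \in r -> S s) ->
  len (\prod_(s <- r) s)%g = size r ->
  (forall s, s \in r -> len v = (len (s * v)%g).+1) ->
  ~ deg_le (f (\prod_(s <- r) s)%g v v) ((size r)%:Z - 1).
Proof.
elim/last_ind: r => [|r s IH] Sr lr vr.
  by rewrite big_nil /struct_const Tt_1 mul1r tco_Tt eqxx => /deg_le1.
have Ss : S s by apply: Sr; rewrite mem_rcons mem_head.
have Sr' t : t \in r -> S t by move=> tr; apply: Sr; rewrite mem_rcons in_cons tr orbT.
rewrite big_rcons /= in lr *; rewrite size_rcons in lr *.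
have lr' : len (\prod_(t <- r) t)%g = size r.
  apply/eqP; rewrite eqn_leq (len_le HS) //= -ltnS -lr -addn1 -(len_gen HS Ss).
  exact: len_mul.
rewrite f_gen_down ?lr' ?lr //; last by apply: vr; rewrite mem_rcons mem_head.
(* The assumed bound passes to the [xi] term; cancelling [xi] lowers it by one, as the induction
   hypothesis requires. *)
rewrite addrC => /lead_nonneg_deg_leD H1.
apply: IH => // [t tr|]; first by apply: vr; rewrite mem_rcons in_cons tr orbT.
apply: deg_le_xi; apply: deg_leW (H1 _ _); first by lia.
  by apply: lead_nonneg_xi; apply: f_nonneg.
exact: f_nonneg.
Qed.

End StandardBasis.

(** * The Kazhdan-Lusztig basis, its lattice and the left preorder *)

Section KazhdanLusztigBasis.
Variables (W : groupType) (S : set W).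
Hypothesis HS : coxeter_system S.
Variables (H : algType laurent) (T : W -> H).
Hypothesis HT : hecke_algebra S T.
Variable P : W -> W -> {poly int}.
Hypothesis HP : kazhdan_lusztig S T P.
Implicit Types (w x y z s : W) (u v : H) (a : laurent) (k : int).

Local Notation len := (len S).
Local Notation Tt := (norm_T S T).
Local Notation tco := (norm_coord S T).
Local Notation f := (struct_const S T).
Local Notation C := (Defs.C S T P).
Local Notation h := (Defs.h S T P).
Local Notation le_L := (Defs.le_L S T P).
Local Notation cco := (coord C).

Lemma coord_T_C w y : coord T (C w) y = qhalf (- (len w)%:Z) * eval_q (P y w).
Proof.
rewrite /Defs.C (coordZ (T_basis HT)); congr (_ * _).
have P0 z : ~ bruhat S z w -> eval_q (P z w) = 0.
  by case: HP => PN _ _ _ /PN ->; exact: eval_q0.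
rewrite (@coord_uniq _ _ _ _ (T_basis HT) _ (fun z => eval_q (P z w))) //; split.
  apply: (sub_finite_set _ (finite_bruhat HS w)) => z /=.
  by move=> /eqP nz; apply: contrapT => /P0.
by apply: fsbig_widen => // z [_ /P0 /= ->]; rewrite scale0r.
Qed.

Lemma tco_C w y : tco (C w) y =
  qhalf ((len y)%:Z - (len w)%:Z) * eval_q (P y w).
Proof. by rewrite /norm_coord coord_T_C mulrA -qhalfD. Qed.

Lemma tco_C_diag w : tco (C w) w = 1.
Proof. by case: HP => _ P1 _ _; rewrite tco_C P1 eval_q1 mulr1 subrr qhalf0. Qed.

Lemma tco_C_len w y : tco (C w) y != 0 -> y = w \/ (len y < len w)%N.
Proof.
move=> /eqP nz; apply: bruhat_len; apply: contrapT => Nyw; apply: nz.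
by case: HP => PN _ _ _; rewrite tco_C PN // eval_q0 mulr0.
Qed.

(** The normalization contributes l(y) - l(w) and the polynomial at most l(w) - l(y) - 1, because q
    has degree 2. *)
Lemma tco_C_deg w y : y <> w -> deg_le (tco (C w) y) (-1).
Proof.
move=> yw; case: HP => PN _ Pdeg _; rewrite tco_C.
have [by_w|/PN ->] := pselect (bruhat S y w); last first.
  by rewrite eval_q0 mulr0; exact: deg_le0.
have lyw : (len y < len w)%N by have [/yw|] := bruhat_len by_w.
have Pyw := Pdeg _ _ by_w yw.
rewrite [-1](_ : _ = ((len y)%:Z - (len w)%:Z) + ((len w)%:Z - (len y)%:Z - 1)); last by ring.
apply: deg_leM; first exact: deg_le_qhalf.
by apply: deg_le_eval_q; [lia|move: Pyw lyw; move: (size _) => n; lia].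
Qed.

Lemma deg_le_tco_C w y : deg_le (tco (C w) y) 0.
Proof.
have [->|/eqP yw] := eqVneq y w; first by rewrite tco_C_diag; apply/deg_le1.
by apply: deg_leW (tco_C_deg yw).
Qed.

(** Unitriangularity in the form of an induction principle: the difference combines shorter T~_y
    with coefficients of negative degree. It serves for supports and for degrees. *)
Lemma Tt_sub_C w (Q : H -> Prop) : Q 0 ->
  (forall a y u, deg_le a (-1) -> (len y < len w)%N -> Q u -> Q (a *: Tt y + u)) ->
  Q (Tt w - C w).
Proof.
move=> Q0 QD; apply: (is_coords_ind (is_coords_tco HT (Tt w - C w))) => // y u.
rewrite (tcoB HT) (tco_Tt HT); case: (eqVneq y w) => [->|/eqP yw].
  by rewrite tco_C_diag subrr eqxx.
rewrite sub0r oppr_eq0 => /tco_C_len[/yw//|lt]; apply: QD => //.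
by apply: deg_leN; exact: tco_C_deg.
Qed.

Lemma C_coords_ex u : exists c, is_coords C u c.
Proof.
have Cex w : exists c, is_coords C (Tt w) c.
  have [n] := ubnP (len w); elim: n w => // n IH w ltn.
  suff [c cE] : exists c, is_coords C (Tt w - C w) c.
    exists (fun i => c i + (i == w)%:R); rewrite -[Tt w](subrK (C w)).
    by apply: is_coordsD => //; exact: is_coords_elt.
  apply: (Tt_sub_C (Q := fun u => exists c, is_coords C u c)) => [|a y v _ lt [c cE]].
    by exists (fun=> 0); exact: is_coords0.
  have [d dE] := IH y (leq_trans lt ltn).
  by exists (fun i => a * d i + c i); apply: is_coordsD => //; exact: is_coordsZ.
apply: (Tt_ind HT (Q := fun u => exists c, is_coords C u c)) u => [|a w u [c cE]].
  by exists (fun=> 0); exact: is_coords0.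
have [d dE] := Cex w.
by exists (fun i => a * d i + c i); apply: is_coordsD => //; exact: is_coordsZ.
Qed.

Lemma C_coords0 c i : is_coords C 0 c -> c i = 0.
Proof.
move=> [cfin cE]; have [s [sP sE]] := is_coordsP C cfin.
rewrite sE in cE; apply/eqP; apply: contraT => /sP i_s.
(* For j of maximal length in the support, only C_j contributes to the coefficient at T~_j, which is
   therefore c_j. *)
pose j : s := [arg max_(j > [` i_s]%fset) len (val j)]%N.
have jmax z : c z != 0 -> (len z <= len (val j))%N.
  move=> /sP zs; rewrite /j; case: arg_maxnP => // j' _ /(_ [` zs]%fset); exact.
have cj : c (val j) != 0.
  by apply/sP; exact: fsvalP.
have := congr1 (fun u => tco u (val j)) cE; rewrite (tco0 HT).
rewrite (big_morph (fun u => tco u (val j)) (id1 := 0) (op1 := +%R)) ?(tco0 HT) //; last first.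
  by move=> u v; exact: tcoD.
rewrite (bigD1_seq (val j)) ?fset_uniq //=.
rewrite (tcoZ HT) tco_C_diag mulr1 big1_seq ?addr0 => [/esym/eqP|z /andP[zj zs]].
  by rewrite (negbTE cj).
rewrite (tcoZ HT); have [->|/tco_C_len] := eqVneq (tco (C z) (val j)) 0.
  by rewrite mulr0.
case=> [E|lt]; first by rewrite E eqxx in zj.
have /jmax : c z != 0 by apply/sP.
by rewrite leqNgt lt.
Qed.

Lemma C_basis : is_basis C.
Proof.
move=> u; have [c cE] := C_coords_ex u; exists c; split=> // d dE.
apply/funext => i; apply/eqP; rewrite -subr_eq0; apply/eqP.
have := is_coordsD cE (is_coordsZ (-1) dE); rewrite scaleN1r subrr.
by move=> /(C_coords0 i); rewrite mulN1r.
Qed.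

(** This is q^(k/2) times the Z[q^(-1/2)]-lattice spanned by the C_w. *)
Definition lat k u := forall z, deg_le (cco u z) k.

Lemma lat0 k : lat k 0.
Proof. by move=> z; rewrite (coord0 C_basis); exact: deg_le0. Qed.

Lemma latD k u v : lat k u -> lat k v -> lat k (u + v).
Proof. by move=> uk vk z; rewrite (coordD C_basis); exact: deg_leD. Qed.

Lemma latZ j k a u : deg_le a j -> lat k u -> lat (j + k) (a *: u).
Proof. by move=> aj uk z; rewrite (coordZ C_basis); exact: deg_leM. Qed.

Lemma latW j k u : j <= k -> lat j u -> lat k u.
Proof. by move=> jk uj z; apply: deg_leW (uj z). Qed.

Lemma lat_C w : lat 0 (C w).
Proof.
move=> z; rewrite (coord_elt C_basis).
by case: (_ == _); [apply/deg_le1|exact: deg_le0].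
Qed.

Lemma lat_ind k (Q : H -> Prop) u : lat k u -> Q 0 ->
  (forall a w v, deg_le a k -> Q v -> Q (a *: C w + v)) -> Q u.
Proof.
move=> uk Q0 QD; apply: (is_coords_ind (coordP C_basis u)) => // w v _.
by apply: QD; exact: uk.
Qed.

(** Induction on the length: each shorter T~_y lies in the lattice, and its coefficient has degree
    at most -1. *)
Lemma lat_Tt_sub_C w : lat (-1) (Tt w - C w).
Proof.
have [n] := ubnP (len w); elim: n w => // n IH w ltn.
apply: Tt_sub_C => [|a y u am1 lt IHu]; first exact: lat0.
apply: latD => //; rewrite -[-1]addr0; apply: latZ => //.
rewrite -[Tt y](subrK (C y)); apply: latD (lat_C y).
by apply: latW (IH y _) => //; exact: leq_trans lt ltn.
Qed.

Lemma lat_Tt w : lat 0 (Tt w).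
Proof.
rewrite -[Tt w](subrK (C w)); apply: latD (lat_C w).
exact: latW (lat_Tt_sub_C w).
Qed.

Lemma tco_lat k u z : lat k u -> deg_le (tco u z) k.
Proof.
move=> uk; apply: (lat_ind (Q := fun u => deg_le (tco u z) k) uk) => [|a w v ak IH].
  by rewrite (tco0 HT); exact: deg_le0.
rewrite (tcoD HT) (tcoZ HT); apply: deg_leD => //; rewrite -[k]addr0.
by apply: deg_leM => //; exact: deg_le_tco_C.
Qed.

(** Modulo terms of negative degree, the matrix of the C_w in the basis of the T~_z is the
    identity. *)
Lemma tco_sub_cco k u z : lat k u -> deg_le (tco u z - cco u z) (k - 1).
Proof.
move=> uk; apply: (lat_ind (Q := fun u => deg_le (tco u z - cco u z) (k - 1)) uk) => [|a w v ak IH].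
  by rewrite (tco0 HT) (coord0 C_basis) subr0; exact: deg_le0.
rewrite (tcoD HT) (tcoZ HT) (coordD C_basis) (coordZ C_basis) (coord_elt C_basis).
rewrite opprD addrACA -mulrBr; apply: deg_leD => //; apply: deg_leM => //.
have [->|/eqP zw] := eqVneq z w; first by rewrite tco_C_diag subrr; exact: deg_le0.
by rewrite subr0; exact: tco_C_deg.
Qed.

Section BoundedDegree.
Variable N : int.
Hypothesis hN : forall x y z, deg_le (h x y z) N.

Lemma lat_mul j k u v : lat j u -> lat k v -> lat (N + j + k) (u * v).
Proof.
move=> uj vk; apply: (lat_ind (Q := fun u => lat (N + j + k) (u * v)) uj) => [|a w u' aj IH].
  by rewrite mul0r; exact: lat0.
rewrite mulrDl; apply: latD => // {u uj u' IH}.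
rewrite -scalerAl [N + j]addrC -addrA; apply: latZ => //.
apply: (lat_ind (Q := fun v => lat (N + k) (C w * v)) vk) => [|b x v' bk IH].
  by rewrite mulr0; exact: lat0.
rewrite mulrDr -scalerAr; apply: latD => //; rewrite addrC; apply: latZ => //.
exact: hN.
Qed.

(* The coefficients of degree [N] of [f] and [h] agree, since the C- and
   T~-bases span the same Z[q^(-1/2)]-lattice and agree modulo q^(-1/2). *)
Lemma f_sub_h x y z : deg_le (f x y z - h x y z) (N - 1).
Proof.
have -> : f x y z - h x y z = tco (Tt x * Tt y - C x * C y) z +
    (tco (C x * C y) z - cco (C x * C y) z).
  by rewrite (tcoB HT) addrA subrK.
apply: deg_leD; last by apply: tco_sub_cco; exact: hN.
(* Telescoping: T~_x T~_y - C_x C_y = (T~_x - C_x) T~_y + C_x (T~_y - C_y), where each summand has a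
   factor in [lat (-1)]. *)
apply: tco_lat; rewrite -[Tt x * Tt y](subrK (C x * Tt y)) -mulrBl -addrA -mulrBr.
apply: latD.
  rewrite -[N - 1]addr0; apply: lat_mul; [exact: lat_Tt_sub_C|exact: lat_Tt].
by rewrite -[N]addr0; apply: lat_mul; [exact: lat_C|exact: lat_Tt_sub_C].
Qed.

End BoundedDegree.

Lemma C_gen s : S s -> exists a, C s = Tt s + a *: 1.
Proof.
move=> Ss; suff [a E] : exists a, Tt s - C s = a *: 1.
  by exists (- a); rewrite scaleNr -E opprB addrC subrK.
apply: (Tt_sub_C (Q := fun u => exists a, u = a *: 1)) => [|a y u _ lt [b ->]].
  by exists 0; rewrite scale0r.
have -> : y = 1%g by apply: (len_eq0 HS); move: lt; rewrite (len_gen HS Ss); case: (len y).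
by exists (a + b); rewrite scalerDl (Tt_1 HS HT).
Qed.

Lemma le_L_trans x y z : le_L x y -> le_L y z -> le_L x z.
Proof. exact: rt_trans. Qed.

(** The elements supported on {z : z <=_L y} form a left ideal: they are stable under C_s by
    definition, hence under T~_s, under every T~_w, and under [H]. *)
Lemma h_le_L x y z : h x y z != 0 -> le_L z y.
Proof.
pose Q u := forall z, cco u z != 0 -> le_L z y.
have QD u v : Q u -> Q v -> Q (u + v).
  move=> Qu Qv {}z; rewrite (coordD C_basis).
  by have [->|/Qu //] := eqVneq (cco u z) 0; rewrite add0r; exact: Qv.
have QZ a u : Q u -> Q (a *: u).
  move=> Qu {}z; rewrite (coordZ C_basis).
  by have [->|/Qu //] := eqVneq (cco u z) 0; rewrite mulr0 eqxx.
have Q0 : Q 0 by move=> {}z; rewrite (coord0 C_basis) eqxx.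
have QC s u : S s -> Q u -> Q (C s * u).
  move=> Ss Qu.
  apply: (is_coords_ind (Q := fun v => Q (C s * v)) (coordP C_basis u)).
    by rewrite mulr0; exact: Q0.
  move=> w v /Qu wy Qv.
  rewrite mulrDr -scalerAr; apply: QD Qv; apply: QZ => {}z nz.
  by apply: le_L_trans wy; apply: rt_step; exists s.
have QT w u : Q u -> Q (Tt w * u).
  move: w u; apply: (len_ind HS) => [u|s w Ss lw IH u Qu].
    by rewrite (Tt_1 HS HT) mul1r.
  have E : Tt s * Tt w = Tt (s * w)%g by rewrite (Tt_mul HT) ?lw ?(len_gen HS Ss).
  rewrite -E -mulrA; have [a Cs] := C_gen Ss.
  rewrite -[Tt s](addrK (a *: 1)) -Cs mulrBl -(scalerAl a) mul1r -scaleNr.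
  by apply: QD; [apply: (QC _ _ Ss)|apply: QZ]; exact: IH.
suff Qx u v : Q v -> Q (u * v).
  apply: Qx => {}z; rewrite (coord_elt C_basis); case: (eqVneq z y) => [->|_].
    by move=> _; exact: rt_refl.
  by rewrite mulr0n eqxx.
move=> Qv; apply: (Tt_ind HT (Q := fun u => Q (u * v))) u => [|a w u IH].
  by rewrite mul0r; exact: Q0.
by rewrite mulrDl -scalerAl; apply: QD IH; apply: QZ; exact: QT.
Qed.

(** The inverse of a unitriangular transition matrix is unitriangular. *)
Lemma cco_Tt w : cco (Tt w) w = 1 /\
  forall z, cco (Tt w) z != 0 -> z = w \/ (len z < len w)%N.
Proof.
have [n] := ubnP (len w); elim: n w => // n IH w ltn.
have low z : cco (Tt w - C w) z != 0 -> (len z < len w)%N.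
  apply: (Tt_sub_C (Q := fun u => cco u z != 0 -> (len z < len w)%N)) => [|a y u _ lt IHu].
    by rewrite (coord0 C_basis) eqxx.
  rewrite (coordD C_basis) (coordZ C_basis).
  have [->|/(IH _ (leq_trans lt ltn)).2 zy _] := eqVneq (cco (Tt y) z) 0.
    by rewrite mulr0 add0r; exact: IHu.
  by case: zy => [->|zy]; [exact: lt|exact: ltn_trans zy lt].
have E z : cco (Tt w) z = cco (Tt w - C w) z + (z == w)%:R.
  by rewrite -(coord_elt C_basis) -(coordD C_basis) subrK.
split=> [|z].
  rewrite E eqxx; have [->|/low] := eqVneq (cco (Tt w - C w) w) 0; first by rewrite add0r.
  by rewrite ltnn.
rewrite E; case: (eqVneq z w) => [|zw]; first by left.
by rewrite addr0 => /low; right.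
Qed.

(** Write C_s C_w as T~_(sw) plus a multiple of C_w and a combination of T~_y with l(y) <= l(w).
    Only the first term involves C_(sw), with coefficient 1. *)
Lemma le_L_up s w : S s -> len (s * w)%g = (len w).+1 -> le_L (s * w)%g w.
Proof.
move=> Ss lsw; apply: rt_step; exists s => //.
have [a ->] := C_gen Ss.
have -> : (Tt s + a *: 1) * C w = Tt (s * w)%g + (a *: C w - Tt s * (Tt w - C w)).
  rewrite mulrDl -(scalerAl a) mul1r mulrBr (Tt_mul HT) ?lsw ?(len_gen HS Ss) //.
  by rewrite opprB [RHS]addrCA [X in _ = _ + X]addrC subrK addrC.
have Tlow y : (len y <= len w)%N -> cco (Tt y) (s * w)%g = 0.
  move=> lyw; have [->//|/(cco_Tt y).2] := eqVneq (cco (Tt y) (s * w)%g) 0.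
  case=> [E|]; first by rewrite -E lsw ltnn in lyw.
  by rewrite lsw ltnNge (leq_trans lyw).
rewrite (coordD C_basis) (cco_Tt _).1.
have -> : cco (a *: C w - Tt s * (Tt w - C w)) (s * w)%g = 0.
  rewrite -scaleN1r (coordD C_basis) (coordZ C_basis a) (coordZ C_basis (-1)) (coord_elt C_basis).
  have /negbTE -> : (s * w != w)%g by apply/eqP => E; move: lsw; rewrite E; lia.
  rewrite mulr0 add0r; apply/eqP; rewrite mulN1r oppr_eq0; apply/eqP.
  apply: (Tt_sub_C (Q := fun u => cco (Tt s * u) (s * w)%g = 0)) => [|b y u _ lt IH].
    by rewrite mulr0 (coord0 C_basis).
  rewrite mulrDr -scalerAr (coordD C_basis) (coordZ C_basis) IH addr0.
  have [ly|ly] := len_mulsP HS y Ss.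
    by rewrite (Tt_mul HT) ?ly ?(len_gen HS Ss) // Tlow ?ly // mulr0.
  rewrite (Tt_gen_mul HS HT Ss ly) (coordD C_basis) (coordZ C_basis) !Tlow.
  - by rewrite mulr0 addr0 mulr0.
  - exact: ltnW.
  - by move: lt; rewrite ly; lia.
by rewrite addr0 oner_eq0.
Qed.

End KazhdanLusztigBasis.

(** * Structure constants of maximal degree and left cells *)

Section TopDegree.
Variables (W : groupType) (S : set W).
Hypothesis HS : coxeter_system S.
Variables (H : algType laurent) (T : W -> H).
Hypothesis HT : hecke_algebra S T.
Variable P : W -> W -> {poly int}.
Hypothesis HP : kazhdan_lusztig S T P.
Variable N : int.
Hypothesis hN : forall x y z, deg_le (h S T P x y z) N.
Implicit Types w x y z s : W.

Local Notation len := (len S).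
Local Notation f := (struct_const S T).
Local Notation le_L := (Defs.le_L S T P).

Lemma top_le_L_base x y z : ~ deg_le (f x y z) (N - 1) -> le_L z y.
Proof.
move=> top; apply: (h_le_L HS HT HP (x := x)); apply/eqP => h0; apply: top.
by have := f_sub_h HS HT HP hN x y z; rewrite h0 subr0.
Qed.

(** The cyclic and inversion symmetries identify f_{x,y,z^-1} with f_{y,z,x^-1}, f_{y^-1,x^-1,z} and
    f_{x^-1,z^-1,y}; [top_le_L_base] applied to each gives the four relations. *)
Lemma top_le_L x y z : ~ deg_le (f x y z^-1%g) (N - 1) ->
  [/\ le_L x^-1%g z, le_L z x^-1%g, le_L y z^-1%g & le_L z^-1%g y].
Proof.
move=> top; have f2 := f_cyclic HS HT x y z.
have f3 := f_inv HS HT x y z; have f4 := f_inv HS HT y z x.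
have f5 := f_cyclic HS HT y^-1%g x^-1%g z^-1%g; rewrite !invgK in f5.
split.
- by apply: (@top_le_L_base y); rewrite -f2.
- by apply: (@top_le_L_base y^-1%g); rewrite -f3.
- by apply: (@top_le_L_base x^-1%g); rewrite -f5 -f3.
- exact: top_le_L_base top.
Qed.

(* Compare the coefficients of T~_(sw) in (T~_s T~_x) T~_y and T~_s (T~_x T~_y). *)
Lemma top_gen s w x y : S s -> len (s * w)%g = (len w).+1 ->
  ~ deg_le (f x y w) (N - 1) -> exists x', ~ deg_le (f x' y (s * w)%g) (N - 1).
Proof.
move=> Ss lsw top; exists (s * x)%g => top'; apply: top; move: top'.
have := tco_gen_mul HS HT (norm_T S T x * norm_T S T y) Ss (z := (s * w)%g).
rewrite (genK HS) // => /(_ lsw); rewrite mulrA.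
have [lx|lx] := len_mulsP HS x Ss.
  have -> : norm_T S T s * norm_T S T x = norm_T S T (s * x)%g.
    by rewrite (Tt_mul HT) ?lx ?(len_gen HS Ss).
  move=> fE; rewrite /struct_const fE; apply: lead_nonneg_deg_leD.
    exact: f_nonneg.
  by apply: lead_nonneg_xi; exact: f_nonneg.
(* When sx < x, the term xi f_{x,y,sw} occurs on both sides and cancels, leaving f_{sx,y,sw} =
   f_{x,y,w}. *)
rewrite (Tt_gen_mul HS HT Ss lx) mulrDl -(scalerAl xi) (tcoD HT) (tcoZ HT xi).
by move=> /addIr fE; rewrite /struct_const fE.
Qed.

(** The second index y is unchanged by [top_gen], so it links the two elements: w <=_L y <=_L sw. *)
Lemma top_up_le_L s w x y : S s -> len (s * w)%g = (len w).+1 ->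
  ~ deg_le (f x y w) (N - 1) -> le_L w (s * w)%g.
Proof.
move=> Ss lsw top; have [x' top'] := top_gen Ss lsw top.
rewrite -[w]invgK in top; have [_ _ _ wy] := top_le_L top.
rewrite -[(s * w)%g]invgK in top'; have [_ _ yw _] := top_le_L top'.
by rewrite !invgK in wy yw; apply: le_L_trans wy yw.
Qed.

End TopDegree.

(** Multiply on the left by letters of [J] as long as the length grows. Every element reached is u w
    with u in the parabolic subgroup, so its length is at most l(w_0) + l(w) and the climb stops. *)
Lemma parabolic_climb (W : groupType) (S : set W) (HS : coxeter_system S)
    (J : set W) (JS : J `<=` S) (w0 : W) (Hw0 : longest_element S (generated J) w0)
    (Q : W -> Prop) (w : W) :
  (forall s v, J s -> len S (s * v)%g = (len S v).+1 -> Q v -> Q (s * v)%g) ->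
  Q w -> exists2 v, Q v & forall s, J s -> len S v = (len S (s * v)%g).+1.
Proof.
move=> Qup Qw; pose B := (len S w0 + len S w)%N.
(* The induction is on a strict bound [n] for the room left below [B], which each step upwards
   reduces by one. *)
have climb n u : generated J u -> Q (u * w)%g -> (B - len S (u * w)%g < n)%N ->
    exists2 v, Q v & forall s, J s -> len S v = (len S (s * v)%g).+1.
  elim: n u => // n IH u Ju Qu lt.
  have [top|/existsNP[s /not_implyP[Js ls]]] :=
    pselect (forall s, J s -> len S (u * w)%g = (len S (s * (u * w))%g).+1).
    by exists (u * w)%g.
  have [up|//] := len_mulsP HS (u * w)%g (JS _ Js).
  have Jsu : generated J (s * u)%g.
    move=> G [[G1 GM] JG]; rewrite -[u]invgK; apply: (GM); first exact: JG.
    by rewrite -[(u^-1)%g]mul1g; apply: (GM) => //; apply: Ju; do 2?split.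
  have bound : (len S (s * u * w)%g <= B)%N.
    by apply: leq_trans (len_mul HS _ _) _; rewrite leq_add2r; apply: Hw0.2.
  apply: (IH (s * u)%g) => //; first by rewrite -mulgA; exact: Qup.
  by move: lt bound; rewrite -mulgA up; lia.
apply: (climb (B - len S (1 * w)%g).+1 1%g) => //; last by rewrite mul1g.
by move=> G [[]].
Qed.

Theorem theorem1p5 (W : groupType) (S : set W) (HS : coxeter_system S)
    (H : algType laurent) (T : W -> H) (HT : hecke_algebra S T)
    (P : W -> W -> {poly int}) (HP : kazhdan_lusztig S T P)
    (J : set W) (HJ : J `<=` S) (Jfin : finite_set (generated J))
    (w0 : W) (Hw0 : longest_element S (generated J) w0)
    (Ha : forall w, exists2 n, afun S T P w = Some n & (n <= len S w0)%N) :
  lowest_two_sided_cell S T P (two_sided_cell S T P w0) /\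
  (forall D : set W, lowest_two_sided_cell S T P D ->
     forall w, afun S T P w = Some (len S w0) -> D w).
Proof.
have afunP z n : afun S T P z = Some n -> h_degrees S T P z n /\
    forall i, h_degrees S T P z i -> (i <= n)%N.
  by rewrite /afun; case: xgetP => // _ _ [m -> hm] [<-].
have hN x y z : deg_le (h S T P x y z) (len S w0)%:Z.
  have [->|/has_degree_ex[i hi]] := eqVneq (h S T P x y z) 0; first exact: deg_le0.
  have [n /afunP[_ nmax] le_n] := Ha z.
  (* A negative degree is below l(w_0) trivially; natural degrees are those recorded by
     [h_degrees]. *)
  apply: deg_leW (has_degree_le hi); case: i hi => // i hi.
  by apply: leq_trans le_n; apply: nmax; exists x, y.
have L_LR x y : le_L S T P x y -> le_LR S T P x y by move=> xy; apply: rt_step; left.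
have R_LR x y : le_R S T P x y -> le_LR S T P x y by move=> xy; apply: rt_step; right.
have LR_trans x y z : le_LR S T P x y -> le_LR S T P y z -> le_LR S T P x z.
  exact: rt_trans.
have cell_w0 v : (forall s, J s -> len S v = (len S (s * v)%g).+1) ->
    le_LR S T P w0 v /\ le_LR S T P v w0.
  (* A reduced word of w_0 in [J] consists of l(w_0) descents of v, so f_{w_0,v,v} reaches the top
     degree; with z = v^-1 this gives w_0 ~_R v. *)
  move=> vJ; have [r Jr [rw0 lr]] := generated_reduced HS HJ Hw0.1.
  have := @f_lower _ _ HS _ _ HT r v (fun s sr => HJ s (Jr s sr)).
  rewrite rw0 lr -[X in struct_const _ _ _ _ X]invgK => /(_ erefl (fun s sr => vJ s (Jr s sr))).
  by move=> /(top_le_L HS HT HP hN)[w0v vw0 _ _]; split; exact: R_LR.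
have w0_le w : le_LR S T P w0 w.
  have [v vw vJ] := parabolic_climb HS HJ Hw0 (Q := fun v => le_L S T P v w)
    (fun s v Js up => le_L_trans (le_L_up HS HT HP (HJ s Js) up)) (rt_refl _ _ w).
  exact: LR_trans (cell_w0 v vJ).1 (L_LR _ _ vw).
split.
  split; first by exists w0.
  by move=> _ [w ->]; exists w0, w; split=> //; split; exact: rt_refl.
move=> _ [[d ->] dlow] w /afunP[[x [y /has_degree_gt hw]] _].
(* The top degree is attained by h_{x,y,w}; since f - h has smaller degree, it is attained by
   f_{x,y,w} too. *)
have top : ~ deg_le (struct_const S T x y w) ((len S w0)%:Z - 1).
  move=> fw; apply: hw; rewrite -[h _ _ _ _ _ _](subKr (struct_const S T x y w)).
  by apply: deg_leB fw _; exact: f_sub_h.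
(* The invariant retains a top-degree coefficient with the same y, so that every step upwards also
   gives a relation back to w. *)
pose Q v := le_L S T P w v /\ exists x', ~ deg_le (struct_const S T x' y v) ((len S w0)%:Z - 1).
have [v [wv _] vJ] : exists2 v, Q v & forall s, J s -> len S v = (len S (s * v)%g).+1.
  apply: (parabolic_climb HS HJ Hw0 (w := w)); last by split; [exact: rt_refl|exists x].
  move=> s v Js up [wv [x' topv]]; split; last exact: (top_gen HS HT (HJ s Js) up topv).
  exact: le_L_trans wv (top_up_le_L HS HT HP hN (HJ s Js) up topv).
have w_w0 : le_LR S T P w w0 := LR_trans _ _ _ (L_LR _ _ wv) (cell_w0 v vJ).2.
(* The order on cells only provides representatives a of D and b of the cell of w_0. The chains are
   w <= w_0 <= d and d <= a <= b <= w_0 <= w. *)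
have [a [b [[_ da] [bw0 _] ab]]] : cell_le S T P (two_sided_cell S T P d)
    (two_sided_cell S T P w0) by apply: dlow; exists w0.
split; first exact: LR_trans w_w0 (w0_le d).
exact: LR_trans (LR_trans _ _ _ da ab) (LR_trans _ _ _ bw0 (w0_le w)).
Qed.
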